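(* Let $V$ be a real locally convex topological vector space, $H$ a real Hilbert space, $j:V\to H$ a linear, weak-to-weak continuous operator, and let $\varphi: V\to\mathbb{R}\cup\{+\infty\}$ be convex. Then there exists a convex, proper, lower semicontinuous functional $\varphi^H: H\to\mathbb{R}\cup\{+\infty\}$ such that $\partial_j\varphi\subseteq\partial\varphi^H$.
   Context: For a functional $\varphi$ with values in $\mathbb{R}\cup\{+\infty\}$, the effective domain is $D(\varphi)=\{\varphi<+\infty\}$, and the functional is proper if its effective domain is non-empty. It is lower semicontinuous if the sublevel sets $\{\varphi\le c\}$ are closed for every $c\in\mathbb{R}$. The $j$-subgradient of $\varphi$ is the relation $$\partial_j\varphi=\Big\{(u,f)\in H\times H \;:\; \exists\,\hat u\in D(\varphi)\text{ with } j(\hat u)=u \text{ and, for every }\hat v\in V,\ \liminf_{t\searrow 0}\frac{\varphi(\hat u+t\hat v)-\varphi(\hat u)}{t}\ge\langle f,j(\hat v)\rangle_H\Big\}.$$ For a functional $\psi$ on $H$, $\partial\psi$ denotes the classical subgradient, i.e. the $j$-subgradient for $V=H$ and $j=I$ the identity. *)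

(* Defs.v *)
From HB Require Import structures.
From mathcomp Require Import all_boot all_order all_algebra.
From mathcomp Require Import sesquilinear.
From mathcomp Require Import all_classical all_reals all_analysis.

Set Implicit Arguments.
Unset Strict Implicit.
Unset Printing Implicit Defensive.

Import Order.TTheory GRing.Theory Num.Theory.
Import numFieldNormedType.Exports.

Local Open Scope classical_set_scope.
Local Open Scope ring_scope.

HB.mixin Record NormedModule_hasInner (R : realType) (H : Type)
    & NormedModule R H := {
  inner : {dot H for (@idfun R)} ;
  inner_norm : forall x : H, inner x x = `|x| ^+ 2
}.

#[short(type="hilbertType")]
HB.structure Definition Hilbert (R : realType) :=
  {H of CompleteNormedModule R H & NormedModule_hasInner R H}.

Definition topological_dual (R : realType) (E : tvsType R) :=
  {f : {linear E -> R^o} | continuous f}.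

(* E endowed with the coarsest topology making every element of its
   topological dual continuous *)
Definition weak_topology (R : realType) (E : tvsType R) :=
  sup_topology (fun f : topological_dual E =>
    Topological.class (initial_topology (sval f : E -> R^o))).

HB.instance Definition _ (R : realType) (E : tvsType R) :=
  Topological.on (weak_topology E).

Definition weak_to_weak_continuous (R : realType) (E F : tvsType R)
    (j : E -> F) :=
  continuous (j : weak_topology E -> weak_topology F).

(* Functionals with values in R U {+oo} are functions into \bar R that never
   take the value -oo. *)
Definition Rpinfty_valued (R : realType) (T : Type) (phi : T -> \bar R) :=
  forall x, phi x != -oo%E.

Definition effective_domain (R : realType) (T : Type) (phi : T -> \bar R)
    : set T :=
  [set x | (phi x < +oo)%E].

Definition proper_functional (R : realType) (T : Type) (phi : T -> \bar R) :=
  effective_domain phi !=set0.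

(* At t = 0 and t = 1, the convention 0 * +oo = 0 makes the inequality hold
   trivially. *)
Definition convex_functional (R : realType) (E : lmodType R)
    (phi : E -> \bar R) :=
  forall (x y : E) (t : R), 0 <= t <= 1 ->
    (phi (t *: x + (1 - t) *: y)%R <= t%:E * phi x + (1 - t)%:E * phi y)%E.

Definition lsc_functional (R : realType) (X : topologicalType)
    (phi : X -> \bar R) :=
  forall c : R, closed [set x | (phi x <= c%:E)%E].

Lemma lsc_functionalP (R : realType) (X : topologicalType)
    (phi : X -> \bar R) :
  lsc_functional phi <-> lower_semicontinuous phi.
Proof.
rewrite lower_semicontinuousP; split=> h c.
  rewrite -[X in open X]setCK openC.
  rewrite (_ : ~` _ = [set x | (phi x <= c%:E)%E]) //.
  by apply/seteqP; split=> x /=; rewrite leNgt => /negP.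
rewrite -[X in closed X]setCK closedC.
rewrite (_ : ~` _ = [set x | (c%:E < phi x)%E]) //.
by apply/seteqP; split=> x /=; rewrite ltNge => /negP.
Qed.

Definition jsubgradient (R : realType) (V : lmodType R) (H : hilbertType R)
    (j : V -> H) (phi : V -> \bar R) : set (H * H) :=
  [set uf | exists2 uhat : V,
     effective_domain phi uhat /\ j uhat = uf.1 &
     forall vhat : V,
       ((inner uf.2 (j vhat))%:E <=
        limf_einf (fun t : R => (phi (uhat + t *: vhat)%R - phi uhat) / t%:E)
                  0^'+)%E].

Definition subgradient (R : realType) (H : hilbertType R) (psi : H -> \bar R)
    : set (H * H) :=
  jsubgradient (fun x : H => x) psi.

(* Main.v *)
Require Import Defs.
From HB Require Import structures.
From mathcomp Require Import all_boot all_order all_algebra.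
From mathcomp Require Import all_classical all_reals all_analysis.
From mathcomp Require Import sesquilinear ring lra.

(** Convexity of [phi] makes the difference quotients
    [t |-> (phi (uhat + t *: v) - phi uhat) / t] nondecreasing, so the infinitesimal
    condition in the definition of the j-subgradient is equivalent to the global
    affine minorant condition [phi uhat + <f, j v> <= phi (uhat + v)] for all [v]:
    this is [convex_liminf_supports], with the easy converse [supports_liminf].
    Each pair [(uhat, f)] satisfying it thus produces a continuous affine function
    [x |-> phi uhat + <f, x - j uhat>] on [H], whose pull-back by [j] lies below
    [phi] and touches it at [uhat].

    Let [phiH] be the supremum of all these affine functions. As such it is convex
    and lower semicontinuous. Still [phiH \o j] lies below [phi], which makes [phiH]
    proper, and equality holds at every such [uhat]. Hence at [j uhat] the functional
    [phiH] has the value [phi uhat] and the affine minorant of slope [f] through it,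
    so that [f] is a classical subgradient of [phiH] at [j uhat].

    If the j-subgradient is empty, the supremum would be [-oo] everywhere; any
    constant functional does instead. *)

Set Implicit Arguments.
Unset Strict Implicit.
Unset Printing Implicit Defensive.

Import Order.TTheory GRing.Theory Num.Theory.
Import numFieldNormedType.Exports.

Local Open Scope classical_set_scope.
Local Open Scope ring_scope.

(** * Bounds on a lower limit *)

Lemma limf_einf_ge (R : realType) (T : choiceType) (X : filteredType T)
    (g : X -> \bar R) (F : set_system X) (c : \bar R) :
  (\forall x \near F, (c <= g x)%E) -> (c <= limf_einf g F)%E.
Proof.
move=> cg; rewrite limf_einfE; apply: le_ereal_sup_tmp.
exists (ereal_inf (g @` [set x | (c <= g x)%E])).
  by exists [set x | (c <= g x)%E].
by apply: le_ereal_inf_tmp => _ [x cx <-].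
Qed.

Lemma limf_einf_le (R : realType) (T : choiceType) (X : filteredType T)
    (g : X -> \bar R) (F : set_system X) (c : \bar R) : ProperFilter F ->
  (\forall x \near F, (g x <= c)%E) -> (limf_einf g F <= c)%E.
Proof.
move=> FF gc; rewrite limf_einfE; apply: ge_ereal_sup => _ [A FA <-].
have [x [Ax gxc]] := filter_ex (filterI FA gc).
by apply: le_trans gxc; apply: ereal_inf_lbound; exists x.
Qed.

(** * The inner product *)

(** The rules of bilinear forms, restated for [inner]: [inner] carries its form
    structure on an lmodule obtained by coercion from the Hilbert space, and
    rewriting with the generic rules leaves terms in which [ring] and [field] do not
    recognize equal atoms. *)
Section InnerAlgebra.
Variables (R : realType) (H : hilbertType R).
Implicit Types f x y : H.

Lemma innerC f x : inner f x = inner x f.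
Proof. by rewrite hermC /= expr0 mul1r. Qed.

Lemma innerDr f x y : inner f (x + y) = inner f x + inner f y.
Proof. exact: linearDr. Qed.

Lemma innerNr f x : inner f (- x) = - inner f x.
Proof. exact: linearNr. Qed.

Lemma inner0r f : inner f 0 = 0.
Proof. exact: linear0r. Qed.

Lemma innerZr f x (t : R) : inner f (t *: x) = t * inner f x.
Proof. exact: linearZr. Qed.

Lemma inner_polarization f x :
  inner f x = 4^-1 * (`|f + x| ^+ 2 - `|f - x| ^+ 2).
Proof.
rewrite -!inner_norm !(innerDr, innerNr) !(innerC (f + x)) !(innerC (f - x)).
by rewrite !(innerDr, innerNr) (innerC x f); field.
Qed.

End InnerAlgebra.

(** By polarization, continuity of [inner f] reduces to that of the norm, which
    bypasses the Cauchy-Schwarz inequality. *)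
Lemma inner_continuous (R : realType) (H : hilbertType R) (f : H) :
  continuous (inner f : H -> R).
Proof.
move=> x.
have -> : inner f = fun y => 4^-1 * (`|f + y| ^+ 2 - `|f - y| ^+ 2) :> R.
  by apply/funext => y; exact: inner_polarization.
apply: cvgM; first exact: cvg_cst.
have cvgnorm2 (h : H -> H) : h y @[y --> x] --> h x ->
    `|h y| ^+ 2 @[y --> x] --> `|h x| ^+ 2.
  move=> hx; rewrite expr2; under eq_fun do rewrite expr2.
  by apply: cvgM; exact: cvg_norm.
by apply: cvgB; apply: cvgnorm2; [apply: cvgD|apply: cvgB];
  (exact: cvg_cst || exact: cvg_id).
Qed.

(** * Suprema of families of real functions *)

Section SupFamily.
Variables (R : realType) (I : Type) (S : set I).

Definition sup_family (H : Type) (a : I -> H -> R) (x : H) : \bar R :=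
  ereal_sup [set (a p x)%:E | p in S].

Lemma sup_family_ub (H : Type) (a : I -> H -> R) (p : I) (x : H) : S p ->
  ((a p x)%:E <= sup_family a x)%E.
Proof. by move=> Sp; apply: ereal_sup_ubound; exists p. Qed.

Lemma sup_family_Rpinfty (H : Type) (a : I -> H -> R) : S !=set0 ->
  Rpinfty_valued (sup_family a).
Proof.
move=> [p Sp] x.
by rewrite -ltNye (lt_le_trans (ltNyr _) (sup_family_ub _ _ Sp)).
Qed.

Lemma sup_family_convex (H : lmodType R) (a : I -> H -> R) :
  (forall p x y t, a p (t *: x + (1 - t) *: y) = t * a p x + (1 - t) * a p y) ->
  convex_functional (sup_family a).
Proof.
move=> affa x y t /andP[t0 t1]; apply: ge_ereal_sup => _ [p Sp <-].
rewrite affa EFinD !EFinM.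
by apply: leeD; apply: lee_wpmul2l; rewrite ?lee_fin ?subr_ge0//;
  exact: sup_family_ub.
Qed.

Lemma sup_family_lsc (H : topologicalType) (a : I -> H -> R) :
  (forall p, continuous (a p)) -> lsc_functional (sup_family a).
Proof.
move=> conta c.
rewrite (_ : [set x | _] = \bigcap_(p in S) (a p @^-1` [set r | r <= c])).
  apply: closed_bigI => p _; apply: preimage_closed => [x _|].
    exact: conta.
  exact: closed_le.
apply/seteqP; split => x /=.
  by move=> xc p Sp /=; rewrite -lee_fin; exact: le_trans (sup_family_ub _ _ Sp) xc.
by move=> ax; apply: ge_ereal_sup => _ [p Sp <-]; rewrite lee_fin; exact: ax.
Qed.

End SupFamily.

(** * Global form of the subgradient condition *)

(** [f] defines, through [j], an affine minorant of [phi] that is exact at [uhat];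
    this is the subgradient condition with the lower limit of difference quotients
    eliminated. *)
Definition supports (R : realType) (V : lmodType R) (H : hilbertType R)
    (j : V -> H) (phi : V -> \bar R) (uhat : V) (f : H) :=
  forall v, (phi uhat + (inner f (j v))%:E <= phi (uhat + v)%R)%E.

Lemma domain_fin_num (R : realType) (T : Type) (phi : T -> \bar R) (x : T) :
  Rpinfty_valued phi -> effective_domain phi x -> phi x \is a fin_num.
Proof. by move=> phiNy xdom; rewrite fin_numE phiNy -ltey. Qed.

(** The difference quotients themselves are bounded below by [<f, j v>]. *)
Lemma supports_liminf (R : realType) (V : lmodType R) (H : hilbertType R)
    (j : {linear V -> H}) (phi : V -> \bar R) (uhat : V) (f : H) :
  phi uhat \is a fin_num -> supports j phi uhat f ->
  forall v, ((inner f (j v))%:E <=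
    limf_einf (fun t : R => (phi (uhat + t *: v)%R - phi uhat) / t%:E) 0^'+)%E.
Proof.
move=> fin sup v; apply: limf_einf_ge.
near=> t; have t0 : 0 < t by [].
rewrite inver gt_eqF// lee_pdivlMr// leeBrDl// -EFinM.
by have := sup (t *: v); rewrite linearZ/= innerZr mulrC.
Unshelve. all: by end_near. Qed.

(** By convexity, the difference quotients with step [t <= 1] are at most the one
    with step 1, hence so is their lower limit. *)
Lemma convex_liminf_supports (R : realType) (V : lmodType R) (H : hilbertType R)
    (j : V -> H) (phi : V -> \bar R) (uhat : V) (f : H) :
  Rpinfty_valued phi -> convex_functional phi -> phi uhat \is a fin_num ->
  (forall v, ((inner f (j v))%:E <=
    limf_einf (fun t : R => (phi (uhat + t *: v)%R - phi uhat) / t%:E) 0^'+)%E) ->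
  supports j phi uhat f.
Proof.
move=> phiNy cvx fin liminf v.
have [->|neqy] := eqVneq (phi (uhat + v)) +oo%E; first exact: leey.
have finv : phi (uhat + v) \is a fin_num by rewrite fin_numE phiNy.
rewrite -leeBrDl//; apply: le_trans (liminf v) _.
apply: limf_einf_le; near=> t.
have t0 : 0 < t by [].
have t1 : t <= 1 by near: t; exact: nbhs_right_le.
rewrite inver gt_eqF// lee_pdivrMr// leeBlDr//.
have -> : uhat + t *: v = t *: (uhat + v) + (1 - t) *: uhat.
  by rewrite scalerDr scalerBl scale1r addrAC addrCA subrr addr0 addrC.
apply: le_trans (cvx _ _ t _) _; first by rewrite ltW.
rewrite -(fineK fin) -(fineK finv) -!EFinB -!EFinM -!EFinD lee_fin; lra.
Unshelve. all: by end_near. Qed.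

(** * The functional on the Hilbert space *)

Theorem corollary2p5 (R : realType) (V : tvsType R) (H : hilbertType R)
    (j : {linear V -> H}) (phi : V -> \bar R) :
  weak_to_weak_continuous j ->
  Rpinfty_valued phi ->
  convex_functional phi ->
  exists phiH : H -> \bar R,
    [/\ Rpinfty_valued phiH,
        convex_functional phiH,
        proper_functional phiH,
        lsc_functional phiH &
        jsubgradient j phi `<=` subgradient phiH].
Proof.
move=> _ phiNy cvx.
pose S := [set p : V * H | effective_domain phi p.1 /\ supports j phi p.1 p.2].
pose a (p : V * H) (x : H) : R := fine (phi p.1) + inner p.2 (x - j p.1).
have jsubS u f : jsubgradient j phi (u, f) ->
    exists2 uhat, S (uhat, f) & j uhat = u.
  move=> [uhat [dom ju] liminf]; exists uhat => //; split=> //=.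
  by apply: convex_liminf_supports => //; exact: domain_fin_num.
have [|/set0P[p0 Sp0]] := eqVneq S set0.
  move=> S0; exists (cst 0%E); split=> //.
  - by move=> x y t _; rewrite /cst !mule0 adde0.
  - by exists 0; exact: ltry.
  - by apply/lsc_functionalP => x c c0; exists setT => //; exact: filterT.
  - by move=> [u f] /jsubS[uhat]; rewrite S0.
have below w : (sup_family S a (j w) <= phi w)%E.
  apply: ge_ereal_sup => _ [p [dom sup] <-].
  rewrite /a EFinD fineK; last exact: domain_fin_num.
  by have := sup (w - p.1); rewrite linearB subrKC.
have touch uhat f : S (uhat, f) -> sup_family S a (j uhat) = phi uhat.
  move=> Sp; apply/eqP; rewrite eq_le below/=.
  apply: le_trans (sup_family_ub a (j uhat) Sp).
  rewrite /a/= subrr inner0r addr0 fineK//.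
  by case: Sp => ? _; exact: domain_fin_num.
exists (sup_family S a); split.
- by apply: sup_family_Rpinfty; exists p0.
- apply: sup_family_convex => p x y t.
  rewrite /a !(innerDr, innerNr) !innerZr; ring.
- exists (j p0.1); apply: le_lt_trans (below _) _.
  by case: Sp0.
- apply: sup_family_lsc => p x.
  apply: cvgD; first exact: cvg_cst.
  apply: (@cvg_comp _ _ _ (fun y => y - j p.1) (inner p.2) _
    (nbhs (x - j p.1))); last exact: inner_continuous.
  by apply: cvgB; [exact: cvg_id|exact: cvg_cst].
move=> [u f] /jsubS[uhat Sp /= <-].
have fin : phi uhat \is a fin_num by case: Sp => ? _; exact: domain_fin_num.
exists (j uhat).
  by split=> //; rewrite /effective_domain/= (touch _ _ Sp) ltey_eq fin.
apply: (@supports_liminf _ _ _ idfun); first by rewrite (touch _ _ Sp).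
move=> v; rewrite (touch _ _ Sp); apply: le_trans (sup_family_ub _ _ Sp).
by rewrite /a/= addrAC subrr add0r EFinD fineK.
Qed.
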